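(* Let $n\ge1$, $\alpha=(\alpha_1,\dots,\alpha_n)\in(0,2]^n$, $\beta=(\beta_1,\dots,\beta_n)\in(0,\infty)^n$, and let $X^{\#}_{\alpha,\beta}(t)$, $t\in\mathbb{R}^n$, be the Gaussian sheet with generalized Cauchy covariance, i.e. the centered Gaussian field with covariance $C^{\#}_{\alpha,\beta}(\tau)=\prod_{i=1}^n(1+|\tau_i|^{\alpha_i})^{-\beta_i}$. Then $X^{\#}_{\alpha,\beta}$ is long range dependent if and only if $0<\alpha_i\beta_i\le1$ for some $1\le i\le n$; it is short range dependent if and only if $\alpha_i\beta_i>1$ for all $1\le i\le n$.
   Context: $\mathbb{R}_+$ is the set of positive reals. A stationary centered Gaussian field on $\mathbb{R}^n$ with covariance $C(\tau)$ is long range dependent if $\int_{\mathbb{R}_+^n}|C(\tau)|\,d^n\tau=\infty$; otherwise it is short range dependent. *)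

(* Defs.v *)
From HB Require Import structures.
From mathcomp Require Import all_boot all_order all_algebra.
From mathcomp Require Import all_classical all_reals all_analysis.
Set Implicit Arguments.
Unset Strict Implicit.
Unset Printing Implicit Defensive.
Import Order.TTheory GRing.Theory Num.Theory.
Import numFieldNormedType.Exports.
Local Open Scope classical_set_scope.
Local Open Scope ring_scope.

(* R^n is the type n.-tuple R, with the product sigma-algebra of the library. *)

Definition tuple_add (R : realType) n (s t : n.-tuple R) : n.-tuple R :=
  [tuple tnth s i + tnth t i | i < n].

Definition tuple_consp (R : realType) n (p : R * n.-tuple R) : n.+1.-tuple R :=
  [tuple of p.1 :: p.2].

Definition tuple_unconsp (R : realType) n (t : n.+1.-tuple R) : R * n.-tuple R :=
  (thead t, [tuple of behead t]).

(* Borel-Lebesgue measure on R^n, by iterated products;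
   lebesgue_tuple_box below gives its value on boxes. *)
Fixpoint lebesgue_tuple (R : realType) n : set (n.-tuple R) -> \bar R :=
  match n return set (n.-tuple R) -> \bar R with
  | 0 => @dirac _ _ [tuple] R
  | m.+1 => pushforward (@lebesgue_measure R \x @lebesgue_tuple R m)%E
                        (@tuple_consp R m)
  end.

Section lebesgue_tuple_measure.
Variable R : realType.

Lemma measurable_tuple_consp n :
  measurable_fun [set: R * n.-tuple R] (@tuple_consp R n).
Proof. exact: measurable_cons. Qed.

Lemma measurable_tuple_unconsp n :
  measurable_fun [set: n.+1.-tuple R] (@tuple_unconsp R n).
Proof.
apply/measurable_fun_pairP; split; first exact: measurable_tnth.
exact: measurable_behead.
Qed.

Lemma tuple_conspK n : cancel (@tuple_consp R n) (@tuple_unconsp R n).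
Proof.
move=> [x t]; rewrite /tuple_unconsp theadE; congr pair.
exact/val_inj.
Qed.

Lemma tuple_unconspK n : cancel (@tuple_unconsp R n) (@tuple_consp R n).
Proof. by move=> t; rewrite [RHS]tuple_eta. Qed.

Definition sigma_finite_measure_axioms d (T : measurableType d)
    (m : set T -> \bar R) :=
  [/\ m set0 = 0%E, forall A, (0 <= m A)%E, semi_sigma_additive m &
      sigma_finite setT m].

Lemma sigma_finite_measure_pack d (T : measurableType d)
    (m : set T -> \bar R) : sigma_finite_measure_axioms m ->
  exists mu : {sigma_finite_measure set T -> \bar R}, m = mu.
Proof.
move=> [m0 mge0 madd msf].
pose mu : {measure set T -> \bar R} :=
  HB.pack m (isMeasure.Build _ _ _ m m0 mge0 madd).
pose H := Measure_isSigmaFinite.Build _ _ _ mu msf.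
by exists (HB.pack_for (sigma_finite_measure T R) (Measure.sort mu) H).
Qed.

Lemma pushforward_axioms d d' (T : measurableType d) (T' : measurableType d')
    (nu : {measure set T -> \bar R}) (f : T -> T') (g : T' -> T) :
  sigma_finite setT nu ->
  measurable_fun setT f -> measurable_fun setT g -> cancel f g ->
  sigma_finite_measure_axioms (pushforward nu f).
Proof.
move=> [G GT Goo] mf mg fK; split.
- by rewrite /pushforward preimage_set0 measure0.
- by move=> A; exact: measure_ge0.
- move=> F mF tF mUF; rewrite /pushforward preimage_bigcup.
  apply: measure_semi_sigma_additive.
  + by move=> k; rewrite -[X in measurable X]setTI; exact: mf.
  + apply/trivIsetP => /= i j _ _ ij; rewrite -preimage_setI.
    by move/trivIsetP : tF => /(_ _ _ _ _ ij) ->//; rewrite preimage_set0.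
  + by rewrite -preimage_bigcup -[X in measurable X]setTI; exact: mf.
- exists (fun k => g @^-1` G k); first by rewrite -preimage_bigcup -GT.
  move=> k; split.
    by rewrite -[X in measurable X]setTI; apply: mg => //; exact: (Goo k).1.
  rewrite /pushforward -comp_preimage (_ : _ \o _ = id); first exact: (Goo k).2.
  by apply/funext => p /=; rewrite fK.
Qed.

Lemma product_measure1_sigma_finite d1 d2 (T1 : measurableType d1)
    (T2 : measurableType d2)
    (m1 : {sigma_finite_measure set T1 -> \bar R})
    (m2 : {sigma_finite_measure set T2 -> \bar R}) :
  sigma_finite setT (m1 \x m2)%E.
Proof.
have /sigma_finiteP[F [TF ndF Foo]] := sigma_finiteT m1.
have /sigma_finiteP[G [TG ndG Goo]] := sigma_finiteT m2.
exists (fun n => F n `*` G n).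
  rewrite -setXTT TF TG predeqE => -[x y]; split.
    move=> [/= [n _ Fnx] [k _ Gky]]; exists (maxn n k) => //; split.
    - by move: x Fnx; exact/subsetPset/ndF/leq_maxl.
    - by move: y Gky; exact/subsetPset/ndG/leq_maxr.
  by move=> [n _ []/= ? ?]; split; exists n.
move=> k; have [? ?] := Foo k; have [? ?] := Goo k.
split; first exact: measurableX.
by rewrite product_measure1E// lte_mul_pinfty// ge0_fin_numE.
Qed.

Lemma pushforward_prod_axioms d1 d2 d' (T1 : measurableType d1)
    (T2 : measurableType d2) (T' : measurableType d')
    (m1 : {sigma_finite_measure set T1 -> \bar R})
    (m2 : {sigma_finite_measure set T2 -> \bar R})
    (f : T1 * T2 -> T') (g : T' -> T1 * T2) :
  measurable_fun setT f -> measurable_fun setT g -> cancel f g ->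
  sigma_finite_measure_axioms (pushforward (m1 \x m2)%E f).
Proof. by apply: pushforward_axioms; exact: product_measure1_sigma_finite. Qed.

Lemma lebesgue_tuple_axioms n :
  sigma_finite_measure_axioms (@lebesgue_tuple R n).
Proof.
elim: n => [|n [m0 mge0 madd msf]] /=.
  split=> //.
  - exact: measure_semi_sigma_additive.
  - exact: sigma_finiteT.
have [mu ->] := sigma_finite_measure_pack (And4 m0 mge0 madd msf).
have := @pushforward_prod_axioms _ _ _ _ _ _ (@lebesgue_measure R) mu
  (@tuple_consp R n) (@tuple_unconsp R n).
apply; [exact: measurable_tuple_consp|exact: measurable_tuple_unconsp|].
exact: tuple_conspK.
Qed.

Section instances.
Variable n : nat.

Let lebesgue_tuple0 : @lebesgue_tuple R n set0 = 0%E.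
Proof. by case: (lebesgue_tuple_axioms n). Qed.

Let lebesgue_tuple_ge0 A : (0 <= @lebesgue_tuple R n A)%E.
Proof. by case: (lebesgue_tuple_axioms n) => _ /(_ A). Qed.

Let lebesgue_tuple_sigma_additive : semi_sigma_additive (@lebesgue_tuple R n).
Proof. by case: (lebesgue_tuple_axioms n). Qed.

HB.instance Definition _ := isMeasure.Build _ _ _ (@lebesgue_tuple R n)
  lebesgue_tuple0 lebesgue_tuple_ge0 lebesgue_tuple_sigma_additive.

Let lebesgue_tuple_sigma_finite : sigma_finite setT (@lebesgue_tuple R n).
Proof. by case: (lebesgue_tuple_axioms n). Qed.

HB.instance Definition _ := Measure_isSigmaFinite.Build _ _ _
  (@lebesgue_tuple R n) lebesgue_tuple_sigma_finite.

End instances.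

Lemma lebesgue_tuple_box n (A : 'I_n -> set R) :
  (forall i, measurable (A i)) ->
  lebesgue_tuple [set t : n.-tuple R | forall i, A i (tnth t i)] =
  (\prod_(i < n) lebesgue_measure (A i))%E.
Proof.
elim: n A => [|n IH] A mA.
  by rewrite big_ord0 /= diracE mem_set//; case.
rewrite big_ord_recl -IH /=; last by move=> i; exact: mA.
rewrite /pushforward.
set B := [set t : n.-tuple R | forall i, _].
have mB : measurable B.
  rewrite (_ : B = \bigcap_(i in [set: 'I_n])
      ((fun t => tnth t i) @^-1` A (lift ord0 i))); last first.
    by apply/seteqP; split=> t Bt i; [move=> _; exact: Bt|exact: Bt].
  apply: fin_bigcap_measurable; first exact: finite_finset.
  move=> i _; rewrite -[X in measurable X]setTI.
  by apply: measurable_tnth => //; exact: mA.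
have -> : @tuple_consp R n @^-1` [set t | forall i, A i (tnth t i)] = A ord0 `*` B.
  apply/seteqP; split=> -[x t] /=.
    move=> H; split; first by have := H ord0; rewrite tnth0.
    by move=> i; have := H (lift ord0 i); rewrite tnthS.
  move=> [Ax Bt] i; case: (unliftP ord0 i) => [j ->|->].
    by rewrite tnthS; exact: Bt.
  by rewrite tnth0.
have := @product_measure1E _ _ _ _ _ (@lebesgue_measure R) (@lebesgue_tuple R n).
by apply => //; exact: mA.
Qed.

End lebesgue_tuple_measure.

Section gaussian_fields.
Context d (T : measurableType d) (R : realType) (P : probability T R) (n : nat).
Implicit Types (X : n.-tuple R -> {RV P >-> R}) (C : n.-tuple R -> R).

(* normal_prob m 0 is a junk value of the library: a degenerate normal law
   is a Dirac mass. *)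
Definition gaussian_law (m s : R) : set R -> \bar R :=
  if s == 0 then dirac m else normal_prob m s.

Definition gaussian_field X :=
  forall (k : nat) (t : 'I_k -> n.-tuple R) (a : 'I_k -> R),
  exists m s : R, forall A : set R, measurable A ->
    pushforward P (fun w => \sum_(i < k) a i * X (t i) w) A = gaussian_law m s A.

Definition centered_field X := forall t, ('E_P[X t] = 0)%E.

(* The covariance depends on the lag tau only, which is stationarity for
   centered Gaussian fields. *)
Definition has_covariance X C :=
  forall t tau, covariance P (X (tuple_add t tau)) (X t) = (C tau)%:E.

Definition stationary_centered_gaussian_field X C :=
  [/\ gaussian_field X, centered_field X & has_covariance X C].

Definition positive_orthant : set (n.-tuple R) :=
  [set t | forall i, 0 < tnth t i].

Definition long_range_dependent X :=
  exists C, stationary_centered_gaussian_field X C /\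
    (\int[@lebesgue_tuple R n]_(tau in positive_orthant) `|C tau|%:E = +oo)%E.

Definition short_range_dependent X :=
  (exists C, stationary_centered_gaussian_field X C) /\
  ~ long_range_dependent X.

End gaussian_fields.

Definition cauchy_covariance (R : realType) n (alpha beta : 'I_n -> R)
    (tau : n.-tuple R) : R :=
  \prod_(i < n) (1 + `|tnth tau i| `^ alpha i) `^ (- beta i).

(* Main.v *)
(** The covariance function of the field is determined by the field, so the
long range condition is about the integral of the Cauchy covariance over the
positive orthant. By Tonelli this integral is the product of the integrals of
[(1 + x^a)^-b] over [x > 0]. These are positive, so the product is infinite iff
one factor is. On [0, 1] the factor is bounded; on [1, oo) it is at most
[x^-(ab)], and at least [2^-b x^-(ab)], hence at least [2^-b / x] if
[ab <= 1]. *)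

Require Import Defs.
From mathcomp Require Import all_boot all_order all_algebra.
From mathcomp Require Import all_classical all_reals all_analysis.
From mathcomp Require Import measurable_realfun lra.
Import Order.TTheory GRing.Theory Num.Theory.
Import numFieldNormedType.Exports.
Local Open Scope classical_set_scope.
Local Open Scope ring_scope.

Set Implicit Arguments.
Unset Strict Implicit.
Unset Printing Implicit Defensive.

(** * Tonelli on tuples, and infinite products of extended reals *)

(** In dimension [n.+1] the measure is by definition a pushforward of a product measure under
    [tuple_consp]: change of variables, then Tonelli. *)
Lemma lebesgue_tupleS_integral (R : realType) (n : nat)
    (f : n.+1.-tuple R -> R) :
  measurable_fun [set: n.+1.-tuple R] f -> (forall t, 0 <= f t) ->
  (\int[@lebesgue_tuple R n.+1]_t (f t)%:E =
   \int[lebesgue_measure]_x \int[@lebesgue_tuple R n]_t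
     (f (tuple_consp (x, t)))%:E)%E.
Proof.
move=> /measurable_EFinP mf f0 /=.
have f0' t : (0 <= (EFin \o f) t)%E by rewrite lee_fin.
pose mu : {measure set _ -> \bar R} := (@lebesgue_measure R \x @lebesgue_tuple R n)%E.
have := @ge0_integral_pushforward _ _ (measurableTypeR R * n.-tuple R)%type _ R
  (@tuple_consp R n) _ mu setT (EFin \o f).
move=> /(_ (@measurable_tuple_consp R n) measurableT mf (fun t _ => f0' t)) ->.
rewrite preimage_setT.
have := @fubini_tonelli1 _ _ _ _ R (@lebesgue_measure R) (@lebesgue_tuple R n)
  (EFin \o f \o @tuple_consp R n).
apply.
  apply: (@measurableT_comp _ _ _ _ _ _ (EFin \o f) _ (@tuple_consp R n)) => //.
  exact: measurable_tuple_consp.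
by move=> p; exact: f0'.
Qed.

Lemma lebesgue_tuple_integral_prod (R : realType) (n : nat)
    (f : 'I_n -> R -> R) :
  (forall i, measurable_fun [set: R] (f i)) -> (forall i x, 0 <= f i x) ->
  (\int[@lebesgue_tuple R n]_t (\prod_(i < n) f i (tnth t i))%:E =
   \prod_(i < n) \int[lebesgue_measure]_x (f i x)%:E)%E.
Proof.
(* Proved for every [m] before the induction, because it serves both in dimension [n] and in
   dimension [n.+1]. *)
have mprod m (g : 'I_m -> R -> R) : (forall i, measurable_fun [set: R] (g i)) ->
    measurable_fun [set: m.-tuple R] (fun t => \prod_(i < m) g i (tnth t i)).
  move=> mg; apply: measurable_prod => i _.
  by apply: measurableT_comp => //; exact: measurable_tnth.
elim: n f => [|n IH] f mf f0.
  under eq_integral do rewrite big_ord0.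
  rewrite big_ord0 /= integral_dirac//.
  by rewrite diracE mem_set// mul1e.
have tail0 t : 0 <= \prod_(i < n) f (lift ord0 i) (tnth t i).
  by apply: prodr_ge0 => i _; exact: f0.
have mtail := mprod n (fun i => f (lift ord0 i)) (fun i => mf _).
rewrite lebesgue_tupleS_integral; last 2 first.
- exact: mprod.
- by move=> t; rewrite prodr_ge0.
(* The product of integrals is turned into an iterated integral: the tail integral moves under the
   outer integral, then the head factor moves under the inner one. *)
rewrite [in RHS]big_ord_recl -(IH (fun i => f (lift ord0 i)))//.
rewrite -ge0_integralZr//; last 3 first.
- by apply/measurable_EFinP; exact: (mf ord0).
- by move=> x _; rewrite lee_fin.
- by apply: integral_ge0 => t _; rewrite lee_fin.
apply: eq_integral => x _.
rewrite -ge0_integralZl//; last 3 first.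
- exact/measurable_EFinP.
- by move=> t _; rewrite lee_fin.
- by rewrite lee_fin.
apply: eq_integral => t _; rewrite big_ord_recl tnth0 EFinM.
by congr (_ * EFin _)%E; apply: eq_bigr => i _; rewrite tnthS.
Qed.

(** Finite factors have a finite product. Conversely, strict positivity keeps an infinite factor
    from meeting a zero, since [0 * +oo] is [0]. *)
Lemma prode_eqy (R : realDomainType) (I : finType) (u : I -> \bar R) :
  (forall i, 0 < u i)%E ->
  (\prod_i u i = +oo)%E <-> exists i, u i = +oo%E.
Proof.
move=> u0; split=> [uy|[i ui]].
  apply: contrapT => /forallNP uNy.
  have : (\prod_i u i)%E \is a fin_num.
    apply: prode_fin_num => i _; rewrite ge0_fin_numE ?(ltW (u0 i))//.
    by rewrite ltey; apply/eqP/uNy.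
  by rewrite uy.
rewrite (bigD1 i)//= ui gt0_mulye//.
by elim/big_ind : _ => // x y x0 y0; rewrite mule_gt0.
Qed.

(** * Integrals of powers *)

Lemma powR_Ngt0_cvgy0 (R : realType) (r : R) : 0 < r ->
  x `^ (- r) @[x --> +oo] --> 0.
Proof.
move=> r0; apply/cvgrPdist_lt => e e0.
near=> x.
have x0 : 0 < x by near: x; exact: nbhs_pinfty_gt.
rewrite sub0r normrN ger0_norm ?powR_ge0// powRN.
rewrite invf_plt ?posrE ?powR_gt0//.
have xe : e^-1 `^ r^-1 < x by near: x; exact: nbhs_pinfty_gt.
have := gt0_ltr_powR r0 _ _ xe; rewrite !nnegrE powR_ge0 (ltW x0).
by rewrite -powRrM mulVf ?gt_eqF// powRr1 ?invr_ge0 ?(ltW e0)//; apply.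
Unshelve. all: by end_near. Qed.

Lemma continuous_powR (R : realType) (a x : R) : 0 < x ->
  {for x, continuous (@powR R ^~ a)}.
Proof.
move=> x0; apply: differentiable_continuous; rewrite -derivable1_diffP.
by apply: ex_derive; exact: is_derive1_powR.
Qed.

Lemma integral_powR_tail_lty (R : realType) (p : R) : 1 < p ->
  (\int[lebesgue_measure]_(x in `[1%R, +oo[) (x `^ (- p))%:E < +oo)%E.
Proof.
move=> p1.
rewrite (@ge0_continuous_FTC2y _ _ (fun x => (1 - p)^-1 * x `^ (1 - p)) 1 0).
- by rewrite -EFinB ltry.
- by move=> x _; exact: powR_ge0.
- apply/continuous_in_subspaceT => x; rewrite inE/= in_itv/= andbT => x1.
  by apply: continuous_powR; exact: lt_le_trans x1.
- rewrite -[X in _ --> X](mulr0 (1 - p)^-1).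
  apply: cvgMr; rewrite -opprB; apply: powR_Ngt0_cvgy0; lra.
- move=> x x1; apply: derivableM => //.
  by apply: ex_derive; apply: is_derive1_powR; exact: lt_trans x1.
- apply: cvg_at_right_filter; apply: cvgMr.
  exact: continuous_powR.
- move=> x; rewrite in_itv/= andbT => x1.
  have x0 : 0 < x by exact: lt_trans x1.
  have H := is_derive1_powR (1 - p) x0.
  rewrite derive1E deriveZ/=; last exact: ex_derive.
  rewrite derive_val /GRing.scale/= mulrA mulVf ?mul1r; last lra.
  by congr powR; lra.
Qed.

(** The endpoint stays finite so that divergence can be proved later by choosing it large enough. *)
Lemma integral_powRN1 (R : realType) (a : R) : 1 < a ->
  (\int[lebesgue_measure]_(x in `[1%R, a]) (x `^ (-1))%:E = (ln a)%:E)%E.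
Proof.
move=> a1; rewrite (@continuous_FTC2 _ _ (@ln R)) ?ln1 ?sube0//.
- apply/continuous_in_subspaceT => x; rewrite inE/= in_itv/= => /andP[x1 _].
  by apply: continuous_powR; exact: lt_le_trans x1.
- split.
  + move=> x; rewrite in_itv/= => /andP[x1 _].
    by apply: ex_derive; apply: is_derive1_ln; exact: lt_trans x1.
  + by apply: cvg_at_right_filter; exact: continuous_ln.
  + by apply: cvg_at_left_filter; apply: continuous_ln; exact: lt_trans a1.
- move=> x; rewrite in_itv/= => /andP[x1 _].
  have x0 : 0 < x by exact: lt_trans x1.
  have H := is_derive1_ln x0.
  by rewrite derive1E derive_val powR_inv1 ?(ltW x0).
Qed.

(** * From the orthant to the half-line *)

(** The indicator of the orthant is a product of half-line indicators, so it can be absorbed into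
    the factors: off the orthant, some restricted factor vanishes. *)
Lemma orthant_integral_prod (R : realType) (n : nat) (f : 'I_n -> R -> R) :
  (forall i, measurable_fun [set: R] (f i)) -> (forall i x, 0 <= f i x) ->
  (\int[@lebesgue_tuple R n]_(t in @positive_orthant R n)
      (\prod_(i < n) f i (tnth t i))%:E =
   \prod_(i < n) \int[lebesgue_measure]_(x in `]0%R, +oo[) (f i x)%:E)%E.
Proof.
move=> mf f0; rewrite integral_mkcond.
transitivity (\int[@lebesgue_tuple R n]_t
    (\prod_(i < n) (f i \_ `]0, +oo[) (tnth t i))%:E)%E.
  apply: eq_integral => t _; rewrite patchE; case: ifPn => [|/negP tN].
    rewrite inE => t0; congr EFin; apply: eq_bigr => i _.
    by rewrite patchE mem_set//= in_itv/= andbT t0.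
  have [i ti] : exists i, ~ 0 < tnth t i.
    by apply/existsNP => t0; apply: tN; rewrite inE.
  rewrite (bigD1 i)//= patchE memNset ?mul0r//= in_itv/= andbT.
  exact: ti.
rewrite (lebesgue_tuple_integral_prod (f := fun i => f i \_ `]0, +oo[)); last 2 first.
- move=> i; apply/(measurable_restrictT _ _).1 => //.
  exact: measurable_funTS.
- by move=> i x; rewrite patchE; case: ifP.
apply: eq_bigr => i _; rewrite [RHS]integral_mkcond.
by apply: eq_integral => x _; rewrite !patchE; case: ifP.
Qed.

(** * The one-dimensional factor: bounds and integrability *)

(** The absolute value is kept so that [cauchy_covariance] unfolds to a product of these factors. *)
Definition cauchy_factor (R : realType) (a b x : R) : R :=
  (1 + `|x| `^ a) `^ (- b).

Lemma measurable_cauchy_factor (R : realType) (a b : R) :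
  measurable_fun [set: R] (cauchy_factor a b).
Proof.
apply: (@measurableT_comp _ _ _ _ _ _ (@powR R ^~ (- b))) => //.
apply: measurable_funD => //.
exact: (@measurableT_comp _ _ _ _ _ _ (@powR R ^~ a)).
Qed.

Lemma cauchy_factor_ge0 (R : realType) (a b x : R) : 0 <= cauchy_factor a b x.
Proof. exact: powR_ge0. Qed.

Section cauchy_factor_integral.
Variables (R : realType) (a b : R).
Hypotheses (a0 : 0 < a) (b0 : 0 < b).

Let mg (D : set R) : measurable_fun D (fun x => (cauchy_factor a b x)%:E).
Proof.
by apply/measurable_EFinP; apply: measurable_funTS; exact: measurable_cauchy_factor.
Qed.

Let powRN_anti (x y : R) : 0 < x -> x <= y -> y `^ (- b) <= x `^ (- b).
Proof.
move=> x0 xy; have y0 := lt_le_trans x0 xy; rewrite !powRN.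
rewrite lef_pV2 ?posrE ?powR_gt0//.
by rewrite ge0_ler_powR ?nnegrE ?(ltW b0) ?(ltW x0) ?(ltW y0).
Qed.

Lemma cauchy_factor_le_powR (x : R) : 0 < x ->
  cauchy_factor a b x <= x `^ (- (a * b)).
Proof.
move=> x0; rewrite -mulrN powRrM /cauchy_factor gtr0_norm//.
by apply: powRN_anti; rewrite ?powR_gt0// lerDr.
Qed.

Lemma cauchy_factor_le1 (x : R) : cauchy_factor a b x <= 1.
Proof.
have := @powRN_anti 1 (1 + `|x| `^ a) ltr01.
by rewrite powR1 lerDl powR_ge0; exact.
Qed.

(** Here [1 +]|x| [^ a] is at most 2. The bound serves to make the integral positive. *)
Lemma cauchy_factor_ge_unit (x : R) : `|x| <= 1 ->
  2 `^ (- b) <= cauchy_factor a b x.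
Proof.
move=> x1; apply: powRN_anti; first by rewrite ltr_wpDr ?powR_ge0.
rewrite -[2]/(1 + 1) lerD2l.
have : `|x| `^ a <= 1 `^ a by rewrite ge0_ler_powR ?nnegrE ?(ltW a0).
by rewrite powR1.
Qed.

(** For [x >= 1], [1 + x]^ a[is at most]2 * x [^ a], and [x]^ (- (a * b))[is at least]x [^ (-1)]. *)
Lemma cauchy_factor_ge_powRN1 (x : R) : a * b <= 1 -> 1 <= x ->
  2 `^ (- b) * x `^ (-1) <= cauchy_factor a b x.
Proof.
move=> ab1 x1; have x0 : 0 < x by exact: lt_le_trans x1.
apply: (@le_trans _ _ ((2 * x `^ a) `^ (- b))).
  rewrite powRM ?powR_ge0// ler_wpM2l ?powR_ge0// -powRrM mulrN.
  by rewrite ler_powR// lerN2.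
rewrite /cauchy_factor gtr0_norm//; apply: powRN_anti.
  by rewrite ltr_wpDr ?powR_ge0.
have : 1 <= x `^ a by rewrite -[leLHS](powRr0 x) ler_powR// ltW.
lra.
Qed.

Lemma cauchy_factor_integral_gt0 :
  (0 < \int[lebesgue_measure]_(x in `]0%R, +oo[) (cauchy_factor a b x)%:E)%E.
Proof.
apply: (@lt_le_trans _ _ (\int[lebesgue_measure]_(x in `]0%R, 1%R]) (2 `^ (- b))%:E)%E).
  rewrite integral_cst//= lebesgue_measure_itv/= lte_fin ltr01 sube0 mule1.
  by rewrite lte_fin powR_gt0.
apply: (@le_trans _ _ (\int[lebesgue_measure]_(x in `]0%R, 1%R]) (cauchy_factor a b x)%:E)%E).
  apply: ge0_le_integral => //.
  - exact: mg.
  - move=> x/=; rewrite in_itv/= => /andP[x0 x1].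
    by rewrite lee_fin cauchy_factor_ge_unit// gtr0_norm.
apply: ge0_subset_integral => //.
- exact: mg.
- by move=> x _; rewrite lee_fin cauchy_factor_ge0.
- by move=> x/=; rewrite !in_itv/= => /andP[->].
Qed.

Lemma cauchy_factor_integral_lty : 1 < a * b ->
  (\int[lebesgue_measure]_(x in `]0%R, +oo[) (cauchy_factor a b x)%:E < +oo)%E.
Proof.
move=> ab1.
have -> : `]0%R, +oo[%classic = `]0%R, 1%R[%classic `|` `[1%R, +oo[%classic :> set R.
  by rewrite -itv_bndbnd_setU// bnd_simp.
rewrite ge0_integral_setU//=; last 3 first.
- exact: mg.
- by move=> x _; rewrite lee_fin cauchy_factor_ge0.
- rewrite disj_set2E; apply/eqP/seteqP; split => // x [] /=.
  by rewrite !in_itv/= andbT => /andP[_ /lt_geF ->].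
apply: lte_add_pinfty.
  apply: (@le_lt_trans _ _ (\int[lebesgue_measure]_(x in `]0%R, 1%R[) 1%:E)%E).
    apply: ge0_le_integral => //.
    - by move=> x _; rewrite lee_fin cauchy_factor_ge0.
    - exact: mg.
    - by move=> x _; rewrite lee_fin cauchy_factor_le1.
  by rewrite integral_cst//= lebesgue_measure_itv/= lte_fin ltr01 sube0 mule1 ltry.
apply: le_lt_trans (integral_powR_tail_lty ab1).
apply: ge0_le_integral => //.
- by move=> x _; rewrite lee_fin cauchy_factor_ge0.
- exact: mg.
- by apply/measurable_EFinP; apply: measurable_funTS; exact: measurable_powR.
- move=> x/=; rewrite in_itv/= andbT => x1.
  by rewrite lee_fin cauchy_factor_le_powR// (lt_le_trans _ x1).
Qed.

Lemma cauchy_factor_integral_eqy : a * b <= 1 ->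
  (\int[lebesgue_measure]_(x in `]0%R, +oo[) (cauchy_factor a b x)%:E = +oo)%E.
Proof.
move=> ab1; apply/eqyP => A A0.
have c0 : 0 < 2 `^ (- b) :> R by rewrite powR_gt0.
pose N := expR (A / 2 `^ (- b)).
have N1 : 1 < N by rewrite expR_gt1 divr_gt0.
have -> : A%:E = (\int[lebesgue_measure]_(x in `[1%R, N]) (2 `^ (- b) * x `^ (-1))%:E)%E.
  under eq_integral do rewrite EFinM.
  rewrite ge0_integralZl//; last 2 first.
  - by apply/measurable_EFinP; apply: measurable_funTS; exact: measurable_powR.
  - by move=> x _; rewrite lee_fin powR_ge0.
  by rewrite integral_powRN1// expRK -EFinM mulrCA divff ?mulr1 ?gt_eqF.
apply: (@le_trans _ _ (\int[lebesgue_measure]_(x in `[1%R, N]) (cauchy_factor a b x)%:E)%E).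
  apply: ge0_le_integral => //.
  - by move=> x _; rewrite lee_fin mulr_ge0 ?powR_ge0.
  - apply/measurable_EFinP; apply: measurable_funTS; apply: measurable_funM => //; exact: measurable_powR.
  - exact: mg.
  - move=> x/=; rewrite in_itv/= => /andP[x1 _].
    by rewrite lee_fin cauchy_factor_ge_powRN1.
apply: ge0_subset_integral => //.
- exact: mg.
- by move=> x _; rewrite lee_fin cauchy_factor_ge0.
- by move=> x/=; rewrite !in_itv/= andbT => /andP[x1 _]; exact: lt_le_trans x1.
Qed.

End cauchy_factor_integral.

(** * The criterion for the field *)

Lemma orthant_integral_cauchy_covarianceP (R : realType) (n : nat)
    (alpha beta : 'I_n -> R) :
  (forall i, 0 < alpha i) -> (forall i, 0 < beta i) ->
  (\int[@lebesgue_tuple R n]_(tau in @positive_orthant R n)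
     `|cauchy_covariance alpha beta tau|%:E = +oo)%E <->
  exists i, alpha i * beta i <= 1.
Proof.
move=> a0 b0.
under eq_integral.
  move=> t _; rewrite ger0_norm; last by apply: prodr_ge0 => i _; exact: powR_ge0.
  over.
rewrite (orthant_integral_prod (f := fun i => cauchy_factor (alpha i) (beta i))).
- rewrite prode_eqy; last by move=> i; exact: cauchy_factor_integral_gt0.
  split=> -[i abi]; exists i; last exact: cauchy_factor_integral_eqy.
  rewrite leNgt; apply/negP => /(cauchy_factor_integral_lty (b0 i)).
  by rewrite abi.
- by move=> i; exact: measurable_cauchy_factor.
- by move=> i x; exact: cauchy_factor_ge0.
Qed.

(** [long_range_dependent] quantifies existentially over the covariance function; uniqueness
    identifies its witness with the Cauchy covariance. *)
Lemma stationary_covariance_unique (R : realType) (n : nat) (d : measure_display)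
    (T : measurableType d) (P : probability T R) (X : n.-tuple R -> {RV P >-> R})
    (C1 C2 : n.-tuple R -> R) :
  has_covariance X C1 -> has_covariance X C2 -> C1 = C2.
Proof.
move=> h1 h2; apply/funext => t.
(* Any base point would do; taking the lag itself avoids naming an origin. *)
by have := h1 t t; rewrite h2 => -[].
Qed.

Unset Implicit Arguments.

Theorem proposition4p7 (R : realType) (n : nat) (n_ge1 : (1 <= n)%N)
    (alpha beta : 'I_n -> R)
    (alpha_range : forall i, 0 < alpha i <= 2)
    (beta_gt0 : forall i, 0 < beta i)
    (d : measure_display) (T : measurableType d) (P : probability T R)
    (X : n.-tuple R -> {RV P >-> R})
    (hX : stationary_centered_gaussian_field X (cauchy_covariance alpha beta)) :
  (long_range_dependent X <-> exists i : 'I_n, 0 < alpha i * beta i <= 1) /\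
  (short_range_dependent X <-> forall i : 'I_n, 1 < alpha i * beta i).
Proof.
have alpha_gt0 i : 0 < alpha i by case/andP: (alpha_range i).
have lrdP : long_range_dependent X <-> exists i, alpha i * beta i <= 1.
  rewrite -orthant_integral_cauchy_covarianceP//; split=> [[C [hC]]|IC].
    have [_ _ cX] := hX; have [_ _ cC] := hC.
    by rewrite (stationary_covariance_unique cX cC).
  by exists (cauchy_covariance alpha beta).
split.
  rewrite lrdP; split=> -[i abi]; exists i; last by case/andP: abi.
  by rewrite mulr_gt0.
(* Since [hX] provides a covariance, short range dependence amounts to the negation of the long
   range criterion. *)
rewrite /short_range_dependent lrdP; split=> [[_ ab] i|ab].
  by rewrite ltNge; apply/negP => abi; apply: ab; exists i.
split; first by exists (cauchy_covariance alpha beta).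
by move=> [i]; rewrite leNgt ab.
Qed.
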